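(* Let $d>k$ be integers and $f:\{1,\dots,d\}\to\mathbb{R}_{>0}$. Assume that for every $j\le d$, \[ \sum_{i=\max(j-k+1,1)}^{j-1}\left(\frac{2\pi e}{j-i}\right)^{\frac{j-i}{2}}\left(1-\left(\frac{f(j)}{f(i)}\right)^2\right)_+^{\frac{j-i}{2}}\left(\prod_{l=i}^{j}\frac{f(i)}{f(l)}\right)<1. \] Then there exists a $k$-BKZ-reduced basis $(\vec b_1,\dots,\vec b_d)$ with $\|\vec b_i^*\|=f(i)$ for all $i$.
   Context: $(x)_+=\max(x,0)$. Gram–Schmidt: $\vec b_i^*=\vec b_i-\sum_{j<i}\mu_{i,j}\vec b_j^*$, $\mu_{i,j}=\langle\vec b_i,\vec b_j^*\rangle/\|\vec b_j^*\|^2$; $\vec b_i(j)$ is the projection of $\vec b_i$ orthogonally to $\vec b_1,\dots,\vec b_{j-1}$. A basis is HKZ-reduced if its first vector is a shortest nonzero lattice vector and recursively the projection of the remaining vectors orthogonally to the first is HKZ-reduced. A basis $(\vec b_1,\dots,\vec b_d)$ is $k$-BKZ-reduced (Block-Korkine-Zolotarev with block-size $k$) if for every $i\le d-k+1$ the $k$-dimensional basis $(\vec b_i(i),\dots,\vec b_{i+k-1}(i))$ is HKZ-reduced. *)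

(* Defs.v *)
From mathcomp Require Import all_boot all_order all_algebra.

Set Implicit Arguments.
Unset Strict Implicit.
Unset Printing Implicit Defensive.

Import Order.TTheory GRing.Theory Num.Theory.
Local Open Scope ring_scope.

Section EuclideanLattices.
Variables (R : rcfType) (n : nat).
Implicit Types (u v w : 'rV[R]_n).

(* The norm that MathComp-Analysis puts on 'rV[R]_n is the sup norm, hence
   the explicit Euclidean one. *)
Definition dot u v : R := \sum_(i < n) u 0 i * v 0 i.

Definition enorm v : R := Num.sqrt (dot v v).

Definition lin_indep m (b : 'I_m -> 'rV[R]_n) : Prop :=
  row_free (\matrix_(i < m) b i).

Definition in_lattice m (b : 'I_m -> 'rV[R]_n) v : Prop :=
  exists z : 'I_m -> int, v = \sum_(i < m) (z i)%:~R *: b i.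

Definition is_shortest m (b : 'I_m -> 'rV[R]_n) v : Prop :=
  [/\ in_lattice b v, v != 0 &
      forall w, in_lattice b w -> w != 0 -> enorm v <= enorm w].

(* Projection of v orthogonally to the row space of A: kermx A^T is the
   orthogonal complement of that row space (see proj_orthP below). *)
Definition proj_orth m (A : 'M[R]_(m, n)) v : 'rV[R]_n :=
  v *m proj_mx (kermx A^T) <<A>>%MS.

(* fuel only makes the recursion structural: any value that is
   at least i gives the same vector (see gsE for the defining equation). *)
Fixpoint gs_rec d (b : 'I_d -> 'rV[R]_n) (fuel : nat) (i : 'I_d) : 'rV[R]_n :=
  if fuel is fuel'.+1 then
    b i - \sum_(j < d | (j < i)%N)
            (dot (b i) (gs_rec b fuel' j)
              / enorm (gs_rec b fuel' j) ^+ 2) *: gs_rec b fuel' j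
  else b i.

Definition gs d (b : 'I_d -> 'rV[R]_n) (i : 'I_d) : 'rV[R]_n := gs_rec b d i.

Definition gs_mu d (b : 'I_d -> 'rV[R]_n) (i j : 'I_d) : R :=
  dot (b i) (gs b j) / enorm (gs b j) ^+ 2.

(* Indices start at 0, so block_proj b j i projects b i orthogonally to the
   j vectors b 0, ..., b (j - 1). *)
Definition block_proj d (b : 'I_d -> 'rV[R]_n) (j : nat) (i : 'I_d) : 'rV[R]_n :=
  proj_orth (\sum_(l < d | (l < j)%N) <<b l>>)%MS (b i).

Fixpoint HKZ_reduced m : ('I_m -> 'rV[R]_n) -> Prop :=
  if m is m'.+1 then fun b =>
    is_shortest b (b ord0) /\
    HKZ_reduced (fun i : 'I_m' => proj_orth (b ord0) (b (lift ord0 i)))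
  else fun=> True.

Definition BKZ_reduced d (k : nat) (b : 'I_d -> 'rV[R]_n) : Prop :=
  forall (i : nat) (ikd : (i + k <= d)%N),
    HKZ_reduced (fun l : 'I_k => block_proj b i (widen_ord ikd (rshift i l))).

Lemma dotE u v : dot u v = (u *m v^T) 0 0.
Proof. by rewrite mxE; apply: eq_bigr => i _; rewrite mxE. Qed.

Lemma dot_ge0 v : 0 <= dot v v.
Proof. by apply: sumr_ge0 => i _; rewrite -expr2 sqr_ge0. Qed.

Lemma dot_eq0 v : dot v v = 0 -> v = 0.
Proof.
move=> /eqP; rewrite psumr_eq0 => [/allP h|i _]; last by rewrite -expr2 sqr_ge0.
apply/rowP => i; rewrite mxE; apply/eqP; rewrite -sqrf_eq0 expr2.
exact: (h i (mem_index_enum i)).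
Qed.

Lemma enorm_sqr v : enorm v ^+ 2 = dot v v.
Proof. by rewrite sqr_sqrtr ?dot_ge0. Qed.

Lemma gsE d (b : 'I_d -> 'rV[R]_n) (i : 'I_d) :
  gs b i = b i - \sum_(j < d | (j < i)%N) gs_mu b i j *: gs b j.
Proof.
have fuel_irr : forall (p q : nat) (j : 'I_d), (j <= p)%N -> (j <= q)%N ->
    gs_rec b p j = gs_rec b q j.
  elim=> [|p IHp] [|q] j //= jp jq.
  - by rewrite big1 ?subr0 // => l; move: jp; rewrite leqn0 => /eqP ->.
  - by rewrite big1 ?subr0 // => l; move: jq; rewrite leqn0 => /eqP ->.
  congr (_ - _); apply: eq_bigr => l lj.
  by rewrite (IHp q l) // -ltnS (leq_trans lj).
have id_le : (i <= d)%N by apply: ltnW.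
by rewrite {1}/gs (fuel_irr d d.+1) // (leq_trans id_le).
Qed.

Lemma proj_orthP m (A : 'M[R]_(m, n)) v w :
  w = proj_orth A v <-> w *m A^T = 0 /\ (v - w <= A)%MS.
Proof.
have cap0 : (kermx A^T :&: <<A>>)%MS = 0.
  apply/eqP/rowV0P => u; rewrite sub_capmx genmxE => /andP[/sub_kermxP uA].
  move=> /submxP[x ux]; apply: dot_eq0.
  by rewrite dotE {2}ux trmx_mul mulmxA uA mul0mx mxE.
have full : row_full (kermx A^T + <<A>>)%MS.
  rewrite -col_leq_rank mxrank_disjoint_sum // mxrank_ker genmxE mxrank_tr.
  by rewrite subnK ?rank_leq_col.
split=> [->|[wA vwA]].
  split; first by apply/sub_kermxP; apply: proj_mx_sub.
  rewrite -(genmxE A); exact: proj_mx_compl_sub (submx_full _ full).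
have -> : proj_orth A v = w *m proj_mx (kermx A^T) <<A>>%MS
    + (v - w) *m proj_mx (kermx A^T) <<A>>%MS.
  by rewrite -mulmxDl addrC subrK.
rewrite (proj_mx_id cap0 (W := w)); last exact/sub_kermxP.
by rewrite (proj_mx_0 cap0) ?addr0 // genmxE.
Qed.

End EuclideanLattices.

(* Main.v *)
(* The basis is built row by row as a lower triangular matrix, whose rows are
   the vectors b_j = f(j) e_j + sum_(l < j) (a_l / N) b_l. The torus average
   of the paper is replaced by a count: N is a large prime and (a_l) ranges
   over [0, N)^j. If x b_j + sum_l z_l b_l, projected orthogonally to the
   first i rows, is shorter than f(i), then the integer vector w = x a + N z
   is the coordinate vector of a short point of a lattice of rank j - i, and
   w determines (a_l)_(i <= l < j) because x is invertible modulo N. The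
   vectors w are counted with a Gaussian weight exp(sigma (r^2 - |w|^2)),
   sigma = (j - i) / (2 r^2): summing one coordinate at a time shows that,
   up to a factor tending to 1 as N grows, there are at most N^(j - i) (2 pi
   e / (j - i))^((j - i) / 2) r^(j - i) / det of them, where r^2 = f(i)^2 -
   f(j)^2 and det = prod_(i <= l < j) f(l). There are at most f(i) / f(j)
   possible values of x. The hypothesis on f says that, for N large enough,
   some choice of a is never bad. *)
Require Import Defs.
From mathcomp Require Import all_boot all_order all_algebra.
From mathcomp Require Import all_classical all_reals all_analysis.
From mathcomp Require Import measurable_realfun.
From mathcomp Require Import ring lra zify.

Import Order.TTheory GRing.Theory Num.Theory.
Local Open Scope ring_scope.

(** * Gaussian sums over arithmetic progressions *)

Lemma le_gauss_fun (R : realType) (x y : R) :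
  0 <= x -> x <= `|y| -> gauss_fun y <= gauss_fun x.
Proof.
move=> x0 xy; rewrite ler_expR lerN2 -(real_normK (num_real y)).
by rewrite ler_pXn2r ?nnegrE.
Qed.

(** The Gaussian decreases on the half-line, so this right Riemann sum lies below its integral
    there. *)
Lemma gauss_right_sum (R : realType) (h : R) (n : nat) : 0 < h ->
  \sum_(m < n) h * gauss_fun (m.+1%:R * h) <= Num.sqrt pi / 2.
Proof.
move=> h0; have mg (D : set R) : measurable D ->
    measurable_fun D (EFin \o (@gauss_fun R)).
  move=> mD; apply/measurable_EFinP.
  by apply: measurable_funTS; exact: measurable_gauss_fun.
have g0 (x : R) : (0 <= (gauss_fun x)%:E)%E by rewrite lee_fin gauss_fun_ge0.
suff : ((\sum_(m < n) h * gauss_fun (m.+1%:R * h))%:E <=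
    \int[lebesgue_measure]_(x in `[0%R, (n%:R * h)%R[) (gauss_fun x)%:E)%E.
  move=> /le_trans le; rewrite -lee_fin -integral0y_gauss; apply: le.
  apply: ge0_subset_integral => //; first exact: mg.
  by apply: subset_itvl.
elim: n => [|n IHn]; first by rewrite big_ord0; apply: integral_ge0.
have nh : 0 <= n%:R * h by rewrite mulr_ge0 // ltW.
have nh1 : n%:R * h <= n.+1%:R * h by rewrite ler_pM2r // ler_nat.
rewrite (_ : `[0, n.+1%:R * h[%classic =
    `[0, n%:R * h[%classic `|` `[n%:R * h, n.+1%:R * h[%classic)%classic; last first.
  by rewrite -itv_bndbnd_setU // bnd_simp.
rewrite ge0_integral_setU //=; last 2 first.
- by apply: mg; exact: measurableU.
- apply/disj_setPLR => x /=; rewrite !in_itv /= => /andP[_ xn].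
  by apply/negP; rewrite negb_and -ltNge xn.
rewrite big_ord_recr /= EFinD leeD //.
apply: (@le_trans _ _ (\int[lebesgue_measure]_(x in `[(n%:R * h)%R, (n.+1%:R * h)%R[)
   cst (gauss_fun (n.+1%:R * h)%R)%:E x)%E).
  rewrite integral_cst //= lebesgue_measure_itv /= lte_fin ltr_pM2r // ltr_nat.
  rewrite ltnSn -EFinD -EFinM lee_fin mulrC.
  by rewrite -mulrBl -natrB // subSnn mul1r.
apply: ge0_le_integral => //.
- by move=> x _; exact: g0.
- exact: mg.
- move=> x /=; rewrite in_itv /= => /andP[nx xn]; rewrite lee_fin.
  apply: le_gauss_fun; first exact: le_trans nx.
  by rewrite (le_trans (ltW xn)) ?ler_norm.
Qed.

(** The [1] pays for the term [m = 0], which the right Riemann sum omits. *)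
Lemma gauss_nat_sum (R : realType) (h : R) (s : seq nat) : 0 < h -> uniq s ->
  \sum_(m <- s) gauss_fun (m%:R * h) <= Num.sqrt pi / 2 / h + 1.
Proof.
move=> h0 us; pose n := (\max_(m <- s) m)%N.
have -> : \sum_(m <- s) gauss_fun (m%:R * h) =
    \sum_(m <- iota 0 n.+1 | m \in s) gauss_fun (m%:R * h).
  rewrite -[RHS]big_filter; apply: perm_big; apply: uniq_perm => //.
    by rewrite filter_uniq ?iota_uniq.
  move=> m; rewrite mem_filter mem_iota ltnS /=; case ms: (m \in s) => //=.
  by rewrite /n (big_rem m) //= leq_maxl.
apply: (@le_trans _ _ (\sum_(m <- iota 0 n.+1) gauss_fun (m%:R * h))).
  rewrite big_mkcond; apply: ler_sum => m _.
  by case: ifP => // _; exact: gauss_fun_ge0.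
rewrite -{1}[n.+1]subn0 -[iota _ _]/(index_iota 0 n.+1) big_nat_recl // addrC.
apply: lerD; last exact: gauss_fun_le1.
rewrite ler_pdivlMr // mulrC mulr_sumr big_mkord.
exact: gauss_right_sum.
Qed.

(** The bound must be uniform in the shift [c]. On either side of the sign change of [z * h + c],
    the points are at least as far from 0 as the successive multiples of [h], so each side costs one
    sum over naturals. *)
Lemma gauss_int_sum (R : realType) (h c : R) (s : seq int) : 0 < h -> uniq s ->
  \sum_(z <- s) gauss_fun (z%:~R * h + c) <= Num.sqrt pi / h + 2.
Proof.
move=> h0 us; pose z0 := Num.ceil (- c / h).
have cz0 : 0 <= z0%:~R * h + c.
  by rewrite -lerBlDr sub0r -ler_pdivrMr // ceil_ge.
have z0c : (z0 - 1)%:~R * h + c < 0.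
  by rewrite -ltrBrDr sub0r -ltr_pdivlMr //; have /andP[] := ceil_itv (- c / h).
have -> : Num.sqrt pi / h + 2 =
    (Num.sqrt pi / 2 / h + 1) + (Num.sqrt pi / 2 / h + 1) :> R.
  by field; rewrite gt_eqF.
rewrite (bigID (fun z => z0 <= z)) /=; apply: lerD.
  apply: le_trans
    (gauss_nat_sum _ _ ([seq absz (z - z0)%R | z <- s & z0 <= z]) h0 _).
    rewrite big_map big_filter; apply: ler_sum => z zz.
    have dz : (absz (z - z0)%R)%:R = (z - z0)%:~R :> R.
      by rewrite natr_absz ger0_norm // subr_ge0.
    apply: le_gauss_fun; first by rewrite mulr_ge0 // ltW.
    rewrite dz rmorphB /= (le_trans _ (ler_norm _)) //.
    by move: cz0; lra.
  rewrite map_inj_in_uniq ?filter_uniq // => x y.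
  rewrite !mem_filter => /andP[zx _] /andP[zy _] /(congr1 Posz).
  by rewrite !gez0_abs ?subr_ge0 // => /addIr.
apply: le_trans
    (gauss_nat_sum _ _ ([seq absz (z0 - 1 - z)%R | z <- s & ~~ (z0 <= z)]) h0 _).
  rewrite big_map big_filter; apply: ler_sum => z zz.
  have dz : (absz (z0 - 1 - z)%R)%:R = (z0 - 1 - z)%:~R :> R.
    rewrite natr_absz ger0_norm //; lia.
  apply: le_gauss_fun; first by rewrite mulr_ge0 // ltW.
  rewrite dz -normrN (le_trans _ (ler_norm _)) // rmorphB /= mulrBl.
  by move: z0c; lra.
rewrite map_inj_in_uniq ?filter_uniq // => x y.
rewrite !mem_filter => /andP[zx _] /andP[zy _] ; lia.
Qed.

(** * Projected lengths and Gaussian sums over lattice points *)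

(* The squared norm of the combination [\sum_(i <= l < j) w l *: B l] of the
   rows of a lower triangular [B], once projected orthogonally to the first
   [i] coordinates; entries of [B] above the diagonal are never read. *)
Definition proj_sqnorm (R : realType) (B : nat -> nat -> R) (i j : nat)
    (w : nat -> R) : R :=
  \sum_(i <= q < j) (\sum_(q <= l < j) w l * B l q) ^+ 2.

Lemma proj_sqnorm_ge0 (R : realType) (B : nat -> nat -> R) i j w :
  0 <= proj_sqnorm R B i j w.
Proof. by apply: sumr_ge0 => q _; exact: sqr_ge0. Qed.

Lemma eq_proj_sqnorm (R : realType) (B B' : nat -> nat -> R) i j w w' :
  (forall l q, (q <= l < j)%N -> B l q = B' l q) ->
  (forall l, (i <= l < j)%N -> w l = w' l) ->
  proj_sqnorm R B i j w = proj_sqnorm R B' i j w'.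
Proof.
move=> eB ew; apply: eq_big_nat => q /andP[iq qj]; congr (_ ^+ 2).
apply: eq_big_nat => l /andP[ql lj].
by rewrite eB ?ql // ew // (leq_trans iq ql).
Qed.

Lemma proj_sqnormZ (R : realType) (B : nat -> nat -> R) i j w c :
  proj_sqnorm R B i j (fun l => c * w l) = c ^+ 2 * proj_sqnorm R B i j w.
Proof.
rewrite /proj_sqnorm mulr_sumr; apply: eq_bigr => q _; rewrite -exprMn mulr_sumr.
by congr (_ ^+ 2); apply: eq_bigr => l _; rewrite mulrA.
Qed.

Lemma sum_fibers (R : realType) (T U : eqType) (p : T -> U) (s : seq T)
    (E : T -> R) :
  \sum_(v <- s) E v = \sum_(t <- undup (map p s)) \sum_(v <- s | p v == t) E v.
Proof.
rewrite (exchange_big_dep xpredT) //= big_seq [RHS]big_seq.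
apply: eq_bigr => v vs; rewrite -big_filter.
rewrite (perm_big [:: p v]) ?big_seq1 //; apply: uniq_perm => //.
  by rewrite filter_uniq ?undup_uniq.
move=> t; rewrite mem_filter mem_undup inE eq_sym; case: eqP => // ->.
by rewrite map_f.
Qed.

(** By triangularity the leading coordinate of [v] enters only the square at [q = i]. For a fixed
    tail, which acts as a shift [c], summing over it is a one-dimensional Gaussian sum; the tails
    are left to the induction. *)
Lemma gauss_lattice_sum (R : realType) (B : nat -> nat -> R) (sigma : R)
    (n i : nat) (s : seq (seq int)) :
  0 < sigma -> (forall l, (i <= l < i + n)%N -> 0 < B l l) ->
  uniq s -> all (fun v => size v == n) s ->
  \sum_(v <- s) expR (- sigma *
      proj_sqnorm R B i (i + n) (fun l => (nth 0 v (l - i))%:~R)) <=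
  \prod_(i <= l < i + n) (Num.sqrt (pi / sigma) / B l l + 2).
Proof.
move=> sigma0; elim: n i s => [|n IHn] i s B0 us ss.
  rewrite addn0 big_geq //; case: s us ss => [|u [|v s]] /=.
  - by rewrite big_nil.
  - by rewrite big_seq1 /proj_sqnorm big_geq // mulr0 expR0.
  - rewrite inE negb_or => /andP[/andP[uv _] _] /and3P[/nilP u0 /nilP v0 _].
    by rewrite u0 v0 eqxx in uv.
have iin : (i < i + n.+1)%N by rewrite addnS ltnS leq_addr.
have Bii : 0 < B i i by apply: B0; rewrite leqnn.
pose c t := \sum_(i.+1 <= l < i + n.+1) (nth 0 t (l - i.+1))%:~R * B l i : R.
pose E t := expR (- sigma *
   proj_sqnorm R B i.+1 (i.+1 + n) (fun l => (nth 0 t (l - i.+1))%:~R)).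
have EE v : v \in s -> expR (- sigma *
    proj_sqnorm R B i (i + n.+1) (fun l => (nth 0 v (l - i))%:~R)) =
    gauss_fun ((head 0 v)%:~R * (Num.sqrt sigma * B i i)
      + Num.sqrt sigma * c (behead v)) * E (behead v).
  move=> vs; case: v vs (allP ss _ vs) => // z t _ _.
  rewrite /E /gauss_fun -expRD /proj_sqnorm big_ltn //; congr expR.
  rewrite [X in X ^+ 2 + _](big_ltn iin) subnn /= mulrDr addnS addSn; congr (_ + _).
    rewrite (_ : z%:~R * _ + _ = Num.sqrt sigma * (z%:~R * B i i + c t));
      last by ring.
    rewrite exprMn sqr_sqrtr ?ltW // mulNr; congr (- (_ * (_ + _) ^+ 2)).
    rewrite /c addnS; apply: eq_big_nat => l /andP[il _].
    by rewrite subnS -[(l - i)%N in LHS]prednK // subn_gt0.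
  congr (_ * _); apply: eq_big_nat => q /andP[iq _]; congr (_ ^+ 2).
  apply: eq_big_nat => l /andP[ql _]; congr (_ * _).
  by rewrite subnS -[(l - i)%N in LHS]prednK // subn_gt0 (leq_trans iq).
rewrite big_seq (eq_bigr _ EE) -big_seq (sum_fibers R _ _ behead) big_ltn //.
apply: (@le_trans _ _ (\sum_(t <- undup (map behead s))
    (Num.sqrt (pi / sigma) / B i i + 2) * E t)).
  apply: ler_sum => t _.
  rewrite (eq_bigr (fun v => gauss_fun ((head 0 v)%:~R * (Num.sqrt sigma * B i i)
      + Num.sqrt sigma * c t) * E t)); last by move=> v /eqP ->.
  rewrite -mulr_suml ler_wpM2r ?expR_ge0 //.
  rewrite -big_filter -(big_map (head 0) xpredT (fun z : int => gauss_fun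
     (z%:~R * (Num.sqrt sigma * B i i) + Num.sqrt sigma * c t))).
  apply: le_trans (gauss_int_sum _ _ _ _ _ _) _.
  - by rewrite mulr_gt0 // sqrtr_gt0.
  - rewrite map_inj_in_uniq ?filter_uniq // => u v.
    rewrite !mem_filter => /andP[/eqP bu us'] /andP[/eqP bv vs'].
    have := allP ss _ us'; have := allP ss _ vs'.
    case: u v bu bv {us' vs'} => [|x u] [|y v] //=. by move=> -> -> _ _ ->.
  - by rewrite lerD2r invfM mulrA (sqrtrM _ (pi_ge0 R)) sqrtrV // ltW.
rewrite -mulr_sumr; apply: ler_wpM2l.
  by rewrite addr_ge0 // divr_ge0 ?sqrtr_ge0 ?ltW.
rewrite /E -addSnnS; apply: IHn => [l /andP[il ln]||].
- by apply: B0; rewrite (ltnW il) -addSnnS.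
- exact: undup_uniq.
- apply/allP => t; rewrite mem_undup => /mapP[v vs ->].
  by rewrite size_behead (eqP (allP ss _ vs)).
Qed.

(** * Counting the digit tuples that create a short vector *)

(** Modulo [N] the terms in [z] and [z'] vanish and [x] is invertible; digits below [N] that agree
    modulo [N] are equal. *)
Lemma prime_residue_inj (N x a a' : nat) (z z' : int) :
  prime N -> (0 < x < N)%N -> (a < N)%N -> (a' < N)%N ->
  N%:Z * z + x%:Z * a%:Z = N%:Z * z' + x%:Z * a'%:Z -> a = a'.
Proof.
move=> pN /andP[x0 xN] aN a'N eq_za.
have : (N %| x%:Z * (a%:Z - a'%:Z))%Z by apply/dvdzP; exists (z' - z); lia.
rewrite Gauss_dvdzr; last first.
  by rewrite /coprimez /= -[_ == _]/(coprime N x) prime_coprime // gtnNdvd.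
by move=> /dvdzP[q]; case: (ltrgtP q 0) => [q0|q0|->]; nia.
Qed.

(** The digits below [i] are invisible after projection, whence the factor [N ^ i]. Once they are
    fixed, distinct bad tuples give distinct vectors [w], each of Gaussian weight at least 1. *)
Lemma card_short_translates (R : realType) (B : nat -> nat -> R) (i j N x : nat)
    (r2 : R) :
  (i < j)%N -> (forall l, (i <= l < j)%N -> 0 < B l l) ->
  prime N -> (0 < x < N)%N -> 0 < r2 ->
  #|[set a : j.-tuple 'I_N | `[< exists z : nat -> int,
      proj_sqnorm R B i j (fun l => (z l)%:~R
        + x%:R * ((nth 0%N (map val a) l)%:R / N%:R)) < r2 >]]|%:R <=
  (N ^ i)%:R * (expR ((j - i)%:R / 2) * \prod_(i <= l < j)
     (N%:R * Num.sqrt (2 * pi * r2 / (j - i)%:R) / B l l + 2)).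
Proof.
move=> ij B0 pN xN r20; set bad := fun _ => _; set C := expR _ * _.
have N0 : 0 < N%:R :> R by rewrite ltr0n prime_gt0.
pose n := (j - i)%N; have n0 : 0 < n%:R :> R by rewrite ltr0n subn_gt0.
have jE : j = (i + n)%N by rewrite subnKC // ltnW.
pose dig (a : j.-tuple 'I_N) l := nth 0%N (map val a) l.
have digN a l : (l < j)%N -> (dig a l < N)%N.
  move=> lj; rewrite /dig (nth_map (Ordinal (prime_gt0 pN))) ?size_tuple //.
  exact: ltn_ord.
have /choice[zf zfP] : forall a, exists z : nat -> int,
    a \in [set a | bad a] -> proj_sqnorm R B i j (fun l => (z l)%:~R
        + x%:R * ((dig a l)%:R / N%:R)) < r2.
  move=> a.
  have [|nb] := boolP (a \in [set a | bad a]); last by exists (fun=> 0).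
  by rewrite inE => /asboolP[z zP]; exists z.
pose w a := mkseq (fun m => N%:Z * zf a (i + m)%N + x%:Z * (dig a (i + m)%N)%:Z) n.
(* The value [n / (2 * r2)] minimizes [expR (s * r2) * (pi / s) ^ (n / 2)] over [s > 0]; the
   division by [N ^ 2] compensates for clearing the denominator [N] in [w]. *)
pose sigma : R := n%:R / (2 * r2) / N%:R ^+ 2.
have sigma0 : 0 < sigma by rewrite !divr_gt0 ?mulr_gt0 ?exprn_gt0.
pose pre (a : j.-tuple 'I_N) := [tuple of take i a].
have fiber p : #|[set a in [set a | bad a] | pre a == p]|%:R <= C.
  set A := [set _ in _ | _].
  apply: (@le_trans _ _ (\sum_(v <- map w (enum A)) (expR (n%:R / 2) * expR (- sigma *
      proj_sqnorm R B i (i + n) (fun l => (nth 0 v (l - i))%:~R))))).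
    rewrite big_map -sum1_card natr_sum big_enum /=; apply: ler_sum => a.
    rewrite inE => /andP[/zfP aP _]; rewrite -expRD (le_trans _ (expR_ge1Dx _)) // lerDl.
    rewrite (eq_proj_sqnorm _ _ B _ _ _ (fun l => N%:R * ((zf a l)%:~R
        + x%:R * ((dig a l)%:R / N%:R)))) => [|//|l /andP[il lj]]; last first.
      rewrite nth_mkseq ?ltn_subLR ?(leq_trans il) // subnKC //.
      rewrite rmorphD !rmorphM /=.
      by rewrite mulrDr; congr (_ + _); rewrite -!pmulrn; field; rewrite gt_eqF.
    rewrite proj_sqnormZ -jE mulNr subr_ge0 mulrA /sigma divfK ?gt_eqF ?exprn_gt0 //.
    move/ltW: aP => aP; apply: (le_trans (ler_wpM2l _ aP)).
      by rewrite ltW // divr_gt0 // mulr_gt0.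
    by rewrite le_eqVlt; apply/orP; left; apply/eqP; field; rewrite gt_eqF.
  rewrite -mulr_sumr ler_pM2l ?expR_gt0 //.
  apply: le_trans (gauss_lattice_sum _ _ _ _ _ _ sigma0 _ _ _) _.
  - by rewrite -jE.
  - rewrite map_inj_in_uniq ?enum_uniq // => a b.
    rewrite !mem_enum !inE => /andP[_ /eqP ap] /andP[_ /eqP bp] wab.
    apply: val_inj; apply: (inj_map val_inj).
    apply: (@eq_from_nth _ 0%N) => [|l]; rewrite ?size_map ?size_tuple // => lj.
    have [li|il] := ltnP l i.
      have := congr1 val (etrans ap (esym bp)) => /= /(congr1 (map val)).
      by rewrite !map_take => /(congr1 (nth 0%N ^~ l)); rewrite !nth_take.
    have := congr1 (nth 0 ^~ (l - i)%N) wab.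
    rewrite !nth_mkseq ?ltn_subLR -?jE // subnKC //.
    by apply: prime_residue_inj => //; exact: digN.
  - by apply/allP => v /mapP[a _ ->]; rewrite size_mkseq.
  rewrite -jE le_eqVlt; apply/orP; left; apply/eqP; apply: eq_big_nat => l _.
  congr (_ / _ + _); rewrite -[in RHS](ger0_norm (ltW N0)) -sqrtr_sqr.
  rewrite -sqrtrM ?sqr_ge0 //; congr Num.sqrt; rewrite /sigma -/n; field.
  by rewrite !gt_eqF.
rewrite -sum1_card (partition_big pre xpredT) //= natr_sum.
apply: (@le_trans _ _ (\sum_(p : (minn i j).-tuple 'I_N) C)).
  apply: ler_sum => p _; apply: le_trans (fiber p).
  by rewrite -sum1_card ler_nat leq_eqVlt; apply/orP; left; apply/eqP;
     apply: eq_bigl => a; rewrite !inE.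
by rewrite sumr_const card_tuple card_ord (minn_idPl (ltnW ij)) mulr_natl.
Qed.

(** * Union bound and existence of a good row *)

Lemma card_bounded_multiples (R : realType) (N : nat) (y : R) : 0 <= y ->
  #|[set x : 'I_N | (0 < x)%N && (x%:R < y)]|%:R <= y.
Proof.
move=> y0; have := truncn_le y; rewrite y0; apply: le_trans; rewrite ler_nat.
rewrite -[leqRHS](size_iota 1) cardE -(size_map val).
apply: uniq_leq_size; first by rewrite (map_inj_uniq val_inj) enum_uniq.
move=> _ /mapP[x + ->]; rewrite mem_enum inE mem_iota => /andP[x0 xy].
by rewrite x0 add1n ltnS truncn_ge_nat // ltW.
Qed.

(** Union bound, used contrapositively: sets of total size below [#|T|] miss a point. *)
Lemma leq_card_cover (T I : finType) (P : pred I) (D : I -> {set T}) :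
  (forall a, exists2 u, P u & a \in D u) -> (#|T| <= \sum_(u | P u) #|D u|)%N.
Proof.
move=> cov; rewrite -cardsT.
apply: (@leq_trans #|\bigcup_(u | P u) D u|).
  by apply/subset_leq_card/fintype.subsetP => a _; apply/bigcupP; exact: cov.
elim/big_rec2: _ => [|u m A _ le_m]; first by rewrite cards0.
by apply: leq_trans (leq_card_setU _ _) _; rewrite leq_add2l.
Qed.

Lemma powR_half (R : realType) (y : R) (n : nat) : 0 <= y ->
  y `^ (n%:R / 2) = Num.sqrt y ^+ n.
Proof. by move=> y0; rewrite mulrC powRrM -powR12_sqrt // powR_mulrn ?powR_ge0. Qed.

(* Bounds, in the limit N -> oo, the proportion of the rows [j] that produce a
   vector shorter than [F i] after projection orthogonally to [i] rows. *)
Definition row_weight (R : realType) (F : nat -> R) (i j : nat) : R :=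
  (2 * pi * expR 1 / (j - i)%:R) `^ ((j - i)%:R / 2)
    * Num.max (1 - (F j / F i) ^+ 2) 0 `^ ((j - i)%:R / 2)
    * \prod_(i <= l < j.+1) (F i / F l).

Lemma row_weight_ge0 (R : realType) (F : nat -> R) i j :
  (forall l, (l <= j)%N -> 0 < F l) -> (i <= j)%N -> 0 <= row_weight R F i j.
Proof.
move=> F0 ij; rewrite /row_weight !mulr_ge0 ?powR_ge0 //.
rewrite big_nat; apply: prodr_ge0 => l /andP[_ lj].
by rewrite divr_ge0 // ltW // F0.
Qed.

(** The factor at [l = j] is [F i / F j], the bound on the number of multipliers [x]. Each of the
    other [j - i] factors takes one square root from the two powers, which cancels its [F i] and
    leaves the main term of one coordinate in the count. *)
Lemma row_weightE (R : realType) (F : nat -> R) i j :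
  (forall l, (l <= j)%N -> 0 < F l) -> (i < j)%N -> F j < F i ->
  row_weight R F i j = F i / F j * (expR ((j - i)%:R / 2) *
    \prod_(i <= l < j)
       (Num.sqrt (2 * pi * (F i ^+ 2 - F j ^+ 2) / (j - i)%:R) / F l)).
Proof.
move=> F0 ij Fij; have Fi := F0 _ (ltnW ij); have Fj := F0 _ (leqnn j).
have n0 : 0 < (j - i)%:R :> R by rewrite ltr0n subn_gt0.
have pi0 := pi_gt0 R.
have r20 : 0 < F i ^+ 2 - F j ^+ 2.
  by rewrite subr_gt0 ltr_pXn2r ?nnegrE ?ltW.
rewrite /row_weight (_ : Num.max _ _ = (F i ^+ 2 - F j ^+ 2) / F i ^+ 2); last first.
  rewrite (_ : 1 - _ = (F i ^+ 2 - F j ^+ 2) / F i ^+ 2).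
    by apply: max_idPl; rewrite divr_ge0 ?ltW ?exprn_gt0.
  by field; rewrite gt_eqF.
set y := _ / (j - i)%:R; set r2 := F i ^+ 2 - F j ^+ 2 in r20 *.
have y0 : 0 <= y by rewrite /y !mulr_ge0 ?expR_ge0 ?invr_ge0 ?ltW.
rewrite -powRM //; last by rewrite divr_ge0 ?ltW ?exprn_gt0.
rewrite powR_half ?mulr_ge0 ?invr_ge0 ?ltW ?exprn_gt0 //.
have key : Num.sqrt (y * (r2 / F i ^+ 2)) * F i =
    Num.sqrt (expR 1) * Num.sqrt (2 * pi * r2 / (j - i)%:R).
  rewrite -{2}(ger0_norm (ltW Fi)) -sqrtr_sqr -!sqrtrM ?expR_ge0 //; last first.
    by rewrite mulr_ge0 // divr_ge0 ?ltW ?exprn_gt0.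
  by congr Num.sqrt; rewrite /y; field; rewrite !gt_eqF.
rewrite big_nat_recr 1?ltnW //= mulrA [LHS]mulrC; congr (_ * _).
rewrite -[X in expR X]mul1r expRM powR_half ?expR_ge0 // -!prodr_const_nat -!big_split.
by apply: eq_bigr => l _; rewrite /= [LHS]mulrA key mulrA.
Qed.

(** Union bound over pairs [(i, x)]. Up to sign, only [F j < F i] and [0 < x < F i / F j] are
    dangerous: otherwise [(x * F j) ^ 2] alone reaches [F i ^ 2]. *)
Lemma exists_good_row (R : realType) (B : nat -> nat -> R) (F : nat -> R)
    (j k : nat) :
  (forall l, (l < j)%N -> B l l = F l) -> (forall l, (l <= j)%N -> 0 < F l) ->
  \sum_(i < j | (j < i + k)%N) row_weight R F i j < 1 ->
  exists a : nat -> R, forall (i : nat) (x : int) (z : nat -> int),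
    (i < j)%N -> (j < i + k)%N -> x != 0 ->
    F i ^+ 2 <= proj_sqnorm R B i j (fun l => (z l)%:~R + x%:~R * a l)
      + (x%:~R * F j) ^+ 2.
Proof.
move=> BF F0 W1; have Fj := F0 _ (leqnn j).
pose P (i : 'I_j) := (j < i + k)%N && (F j < F i).
pose s (i : 'I_j) := Num.sqrt (2 * pi * (F i ^+ 2 - F j ^+ 2) / (j - i)%:R).
(* The value at [1 / N] will bound the proportion of bad tuples, with [2 * e] the error of each
   one-dimensional sum. At 0 it is at most the sum of the weights, so by continuity it stays below 1
   for large [N]. *)
pose p : {poly R} := \sum_(i < j | P i) (F i / F j * expR ((j - i)%:R / 2))%:P *
    \prod_(i <= l < j) ((s i / F l)%:P + 2%:P * 'X).
have pE e : p.[e] = \sum_(i < j | P i) F i / F j * expR ((j - i)%:R / 2) *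
    \prod_(i <= l < j) (s i / F l + 2 * e).
  rewrite horner_sum; apply: eq_bigr => i _.
  rewrite hornerM hornerC horner_prod; congr (_ * _); apply: eq_bigr => l _.
  by rewrite !hornerE.
have p0 : p.[0] < 1.
  apply: le_lt_trans W1; rewrite pE big_mkcondr; apply: ler_sum => i _.
  case: ifP => [Fij|_]; last exact/row_weight_ge0/ltnW.
  by rewrite row_weightE // mulrA; under eq_bigr do rewrite mulr0 addr0.
have [e0 e00 e0P] : exists2 e0 : R, 0 < e0 & forall e, 0 < e -> e < e0 -> p.[e] < 1.
  have /cvgr_lt/(_ _ p0)/nbhs_ballP[e0 /= e00 e0P] := @continuous_horner R p 0.
  exists e0 => // e egt0 ee0; apply: e0P.
  by rewrite /ball /= sub0r normrN gtr0_norm.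
(* The first term forces [1 / N < e0]; the second puts every dangerous [x] below the prime [N],
   hence makes it invertible. *)
pose M : R := e0^-1 + \sum_(i < j) F i / F j.
have sF0 : 0 <= \sum_(i < j) F i / F j.
  by apply: sumr_ge0 => i _; rewrite divr_ge0 // ltW // F0 // ltnW.
have [N MN pN] := prime_above (Num.trunc M).
have {}MN : M < N%:R by rewrite (lt_le_trans (truncnS_gt M)) // ler_nat.
have N0 : 0 < N%:R :> R by rewrite ltr0n prime_gt0.
have FN (i : 'I_j) : F i / F j < N%:R.
  apply: le_lt_trans MN; rewrite /M (bigD1 i) //=.
  rewrite addrCA lerDl addr_ge0 ?invr_ge0 1?(ltW e00) //.
  by apply: sumr_ge0 => l _; rewrite divr_ge0 // ltW // F0 // ltnW.
have pN1 : p.[N%:R^-1] < 1.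
  apply: e0P; rewrite ?invr_gt0 // invf_plt ?posrE //.
  by apply: le_lt_trans MN; rewrite lerDl.
(* As [x >= 1] contributes at least [F j ^ 2], the same squared radius serves for all [x]. *)
pose D (u : 'I_j * 'I_N) := [set a : j.-tuple 'I_N | `[< exists z : nat -> int,
      proj_sqnorm R B u.1 j (fun l => (z l)%:~R
        + (u.2 : nat)%:R * ((nth 0%N (map val a) l)%:R / N%:R))
      < F u.1 ^+ 2 - F j ^+ 2 >]].
pose good (i : 'I_j) := [set x : 'I_N | (0 < x)%N && (x%:R < F i / F j)].
pose U (u : 'I_j * 'I_N) := P u.1 && (u.2 \in good u.1).
have [a aP] : exists a, forall u, U u -> a \notin D u.
  apply/not_existsP => noa.
  have /leq_card_cover : forall a, exists2 u, U u & a \in D u.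
    move=> a; apply/not_exists2P => na; apply: (noa a) => u Uu.
    by have [//|/negP] := na u.
  rewrite leqNgt => /negP; apply; rewrite -(ltr_nat R) natr_sum card_tuple card_ord.
  rewrite -(pair_big_dep P (fun i x => x \in good i) (fun i x => #|D (i, x)|%:R)) /=.
  apply: (@le_lt_trans _ _ ((N ^ j)%:R * p.[N%:R^-1])); last first.
    by rewrite gtr_pMr // ltr0n expn_gt0 prime_gt0.
  rewrite pE mulr_sumr; apply: ler_sum => i /andP[_ Fij].
  have Fi : 0 < F i by rewrite F0 // ltnW.
  have r20 : 0 < F i ^+ 2 - F j ^+ 2.
    by rewrite subr_gt0 ltr_pXn2r ?nnegrE ?ltW.
  pose C := (N ^ i)%:R * (expR ((j - i)%:R / 2) *
     \prod_(i <= l < j) (N%:R * s i / F l + 2)).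
  have CE : (N ^ j)%:R * (F i / F j * expR ((j - i)%:R / 2) *
      \prod_(i <= l < j) (s i / F l + 2 / N%:R)) = F i / F j * C.
    have -> : (N ^ j)%:R = (N ^ i)%:R * \prod_(i <= l < j) (N%:R : R).
      by rewrite prodr_const_nat -natrX -natrM -expnD subnKC // ltnW.
    rewrite /C; have -> : \prod_(i <= l < j) (N%:R * s i / F l + 2) =
        \prod_(i <= l < j) (N%:R : R) * \prod_(i <= l < j) (s i / F l + 2 / N%:R).
      rewrite -big_split; apply: eq_big_nat => l /andP[_ lj] /=.
      by field; rewrite !gt_eqF ?F0 // ltnW.
    by ring.
  rewrite CE; apply: (@le_trans _ _ (\sum_(x in good i) C)).
    apply: ler_sum => x; rewrite inE => /andP[x0 _].
    have := card_short_translates R B i j N x _ (ltn_ord i) _ pN _ r20.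
    rewrite x0 ltn_ord /D /C /=.
    rewrite (eq_big_nat _ _ (F2 := fun l => N%:R * s i / F l + 2)); last first.
      by move=> l /andP[_ lj]; rewrite BF.
    by apply=> // l /andP[_ lj]; rewrite BF // F0 // ltnW.
  rewrite sumr_const -[leLHS]mulr_natl ler_wpM2r //.
    rewrite mulr_ge0 // mulr_ge0 ?expR_ge0 // big_nat; apply: prodr_ge0 => l /andP[_ lj].
    by rewrite addr_ge0 // divr_ge0 ?mulr_ge0 ?sqrtr_ge0 // ltW // F0 // ltnW.
  by apply: card_bounded_multiples; rewrite divr_ge0 ?ltW.
pose al l : R := (nth 0%N (map val a) l)%:R / N%:R.
exists al => i x z ij jik.
have Fi : 0 < F i by rewrite F0 // ltnW.
have pos (y : nat) (z' : nat -> int) : (0 < y)%N ->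
    F i ^+ 2 <= proj_sqnorm R B i j (fun l => (z' l)%:~R + y%:R * al l)
      + (y%:R * F j) ^+ 2.
  move=> y0; rewrite leNgt; apply/negP => short.
  have yF : y%:R * F j < F i.
    rewrite -(ltr_pXn2r (n := 2)) ?nnegrE ?mulr_ge0 ?(ltW Fj) ?(ltW Fi) //.
    by apply: le_lt_trans short; rewrite lerDr proj_sqnorm_ge0.
  have Fij : F j < F i.
    by apply: le_lt_trans yF; rewrite ler_peMl ?ler1n // ltW.
  have yN : (y < N)%N.
    rewrite -(ltr_nat R); apply: lt_trans (FN (Ordinal ij)).
    by rewrite ltr_pdivlMr.
  have /aP : U (Ordinal ij, Ordinal yN).
    by rewrite /U /P /= jik Fij inE y0 ltr_pdivlMr.
  rewrite inE => /negP; apply; apply/asboolP; exists z'.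
  rewrite ltrBrDr; apply: le_lt_trans short; apply: lerD => //.
  rewrite ler_pXn2r ?nnegrE ?mulr_ge0 ?(ltW Fj) //.
  by rewrite ler_peMl ?ler1n // ltW.
case: (ltrgtP x 0) => // x0 _; last first.
  by case: x x0 => // y y0; exact: pos.
(* A negative [x] reduces to [pos] by negating the whole vector. *)
have := pos `|x|%N (fun l => - z l) _; rewrite absz_gt0 lt_eqF // => /(_ isT).
rewrite natr_absz ltr0_norm // rmorphN mulNr sqrrN.
rewrite (_ : proj_sqnorm _ _ _ _ _ = proj_sqnorm R B i j (fun l =>
   -1 * ((z l)%:~R + x%:~R * al l))).
  by rewrite proj_sqnormZ sqrrN expr1n mul1r.
by apply: eq_proj_sqnorm => // l _; rewrite mulN1r opprD rmorphN /= mulNr.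
Qed.

(** * Row-by-row construction of the triangular matrix *)

(** Induction on [d]. The constraint at [(i, j)] reads only rows up to [j], so appending row [m]
    keeps the earlier constraints and adds those with [j = m], which [exists_good_row] supplies for
    [i < m]. *)
Lemma exists_triangular (R : realType) (F : nat -> R) (d k : nat) :
  (forall l, 0 < F l) ->
  (forall j, (j < d)%N ->
     \sum_(i < j | (j < i + k)%N) row_weight R F i j < 1) ->
  exists B : nat -> nat -> R, (forall j, (j < d)%N -> B j j = F j) /\
    forall i j (z : nat -> int), (i <= j < d)%N -> (j < i + k)%N -> z j != 0 ->
      F i ^+ 2 <= proj_sqnorm R B i j.+1 (fun l => (z l)%:~R).
Proof.
move=> F0; elim: d => [|m IHm] W1.
  by exists (fun _ _ => 0); split=> // i j z; rewrite ltn0 andbF.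
have [j jm|B [BF Bshort]] := IHm; first exact/W1/ltnW.
have [a aP] := exists_good_row _ B F m k BF (fun l _ => F0 l) (W1 _ (ltnSn m)).
pose B' l q := if l == m then
  if q == m then F m else \sum_(q <= t < m) a t * B t q else B l q.
have BB' l q : (l < m)%N -> B' l q = B l q by move=> lm; rewrite /B' ltn_eqF.
have B'm q : B' m q = if q == m then F m else \sum_(q <= t < m) a t * B t q.
  by rewrite /B' eqxx.
exists B'; split=> [j|i j z].
  by rewrite ltnS leq_eqVlt => /predU1P[->|jm]; [rewrite B'm eqxx|rewrite BB' ?BF].
rewrite ltnS => /andP[ij]; rewrite leq_eqVlt => /predU1P[jm|jm] jik zj; last first.
  rewrite (eq_proj_sqnorm _ _ B _ _ _ (fun l => (z l)%:~R)) => [|l q /andP[_ lj]|//].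
    by apply: Bshort; rewrite ?ij.
  by rewrite BB' // (leq_ltn_trans _ jm).
rewrite {j}jm in ij jik zj *.
have qm : proj_sqnorm R B' i m.+1 (fun l => (z l)%:~R) =
    proj_sqnorm R B i m (fun l => (z l)%:~R + (z m)%:~R * a l)
      + ((z m)%:~R * F m) ^+ 2.
  rewrite /proj_sqnorm big_nat_recr //= big_nat1 B'm eqxx; congr (_ + _).
  apply: eq_big_nat => q /andP[_ qm]; congr (_ ^+ 2).
  rewrite big_nat_recr ?(ltnW qm) //= B'm ltn_eqF // mulr_sumr -big_split /=.
  by apply: eq_big_nat => l /andP[_ lm]; rewrite BB' // mulrDl mulrA.
(* For [i = m] only the diagonal entry survives, and a nonzero integer has square at least 1. *)
rewrite qm; move: ij; rewrite leq_eqVlt => /predU1P[->|im]; last exact: aP.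
rewrite /proj_sqnorm big_geq // add0r exprMn ler_peMl ?sqr_ge0 //.
rewrite -rmorphXn /= ler1z; nia.
Qed.

(** * Projections and Gram-Schmidt vectors of triangular rows *)

Section TriangularBasis.
Variables (R : realType) (d : nat) (B : nat -> nat -> R) (F : nat -> R).
Hypothesis F_gt0 : forall l, 0 < F l.
Hypothesis B_diag : forall l, (l < d)%N -> B l l = F l.

Definition tri_row (l : nat) : 'rV[R]_d := \row_q (if (q <= l)%N then B l q else 0).

Definition trunc_row (p : nat) (v : 'rV[R]_d) : 'rV[R]_d :=
  \row_q (if (p <= q)%N then v 0 q else 0).

Lemma tri_row_indep : lin_indep (fun i : 'I_d => tri_row i).
Proof.
rewrite /lin_indep row_free_unit unitmxE det_trig.
  rewrite unitfE; apply/prodf_neq0 => i _.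
  by rewrite !mxE leqnn B_diag // gt_eqF.
by apply/is_trig_mxP => i j ij; rewrite !mxE leqNgt ij.
Qed.

(** Back substitution: a multiple of row [p] clears coordinate [p]. *)
Lemma tri_row_span (p : nat) (u : 'rV[R]_d) :
  (forall q : 'I_d, (p <= q)%N -> u 0 q = 0) ->
  (u <= \sum_(l < d | (l < p)%N) <<tri_row l>>)%MS.
Proof.
elim: p u => [|p IHp] u u0.
  by rewrite (_ : u = 0) ?sub0mx //; apply/rowP => q; rewrite mxE u0.
have subS : (\sum_(l < d | (l < p)%N) <<tri_row l>> <=
    \sum_(l < d | (l < p.+1)%N) <<tri_row l>>)%MS.
  by apply/sumsmx_subP => l lp; apply: sumsmx_sup (submx_refl _); exact: ltnW.
have [pd|dp] := ltnP p d; last first.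
  apply: submx_trans subS; apply: IHp => q pq.
  by have := leq_trans (ltn_ord q) (leq_trans dp pq); rewrite ltnn.
pose v := u - (u 0 (Ordinal pd) / F p) *: tri_row p.
rewrite -(subrK ((u 0 (Ordinal pd) / F p) *: tri_row p) u) addmx_sub //.
  apply: submx_trans subS; apply: IHp => q; rewrite leq_eqVlt /v !mxE.
  move=> /predU1P[pq|pq]; last by rewrite (u0 q pq) ifN ?mulr0 ?subrr // -ltnNge.
  rewrite (_ : q = Ordinal pd) /=; last exact: val_inj.
  by rewrite leqnn B_diag // divfK ?subrr // gt_eqF.
apply: scalemx_sub; apply: (sumsmx_sup (Ordinal pd)) => //=.
by rewrite genmxE.
Qed.

(** The first [p] rows live on the first [p] coordinates, and by [tri_row_span] they span that whole
    coordinate subspace. *)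
Lemma proj_orth_tri_rows (p : nat) (v : 'rV[R]_d) :
  proj_orth (\sum_(l < d | (l < p)%N) <<tri_row l>>)%MS v = trunc_row p v.
Proof.
symmetry; apply/proj_orthP; split; last first.
  by apply: tri_row_span => q pq; rewrite !mxE pq subrr.
apply: trmx_inj; rewrite trmx_mul trmxK trmx0.
apply/sub_kermxP/sumsmx_subP => l lp; rewrite genmxE; apply/sub_kermxP/rowP => i.
rewrite !mxE big1 // => q _; rewrite !mxE.
case: ifP => ql; last by rewrite mul0r.
by rewrite leqNgt (leq_ltn_trans ql lp) mulr0.
Qed.

(** Truncated at [p], row [p] is [F p] times a unit vector, so projecting orthogonally to it clears
    just coordinate [p]. This is the recursive step of [HKZ_reduced]. *)
Lemma proj_orth_trunc_row (p : nat) (v : 'rV[R]_d) : (p < d)%N ->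
  proj_orth (trunc_row p (tri_row p)) (trunc_row p v) = trunc_row p.+1 v.
Proof.
move=> pd; symmetry; apply/proj_orthP; split.
  apply/rowP => i; rewrite !mxE big1 // => q _; rewrite !mxE.
  by case: ltngtP => // pq; rewrite ?mul0r ?mulr0.
apply/submxP; exists ((v 0 (Ordinal pd) / F p)%:M); rewrite mul_scalar_mx.
apply/rowP => q; rewrite !mxE; case: ltngtP => // pq.
- by rewrite subrr mulr0.
- by rewrite subrr mulr0.
rewrite subr0 -pq B_diag // divfK ?gt_eqF //; congr (v 0 _); exact: val_inj.
Qed.

(** Strong induction: the earlier Gram-Schmidt vectors are multiples of unit vectors, so the
    subtraction removes precisely the entries left of the diagonal. *)
Lemma gs_tri_row (i : 'I_d) :
  gs (fun i : 'I_d => tri_row i) i = F i *: delta_mx 0 i.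
Proof.
have [n] := ubnP (i : nat); elim: n i => // n IHn i; rewrite ltnS => ni.
rewrite gsE; have -> : \sum_(j < d | (j < i)%N)
    gs_mu (fun i : 'I_d => tri_row i) i j *: gs (fun i : 'I_d => tri_row i) j =
    \sum_(j < d | (j < i)%N) B i j *: delta_mx 0 j.
  apply: eq_bigr => j ji.
  have dot_delta (u : 'rV[R]_d) c : dot u (c *: delta_mx 0 j) = u 0 j * c.
    rewrite /dot (bigD1 j) //= big1 ?addr0 => [|q qj]; first by rewrite !mxE !eqxx mulr1.
    by rewrite !mxE (negPf qj) andbF !mulr0.
  rewrite /gs_mu (IHn j (leq_trans ji ni)) enorm_sqr !dot_delta !mxE !eqxx.
  rewrite mulr1 (ltnW ji) scalerA.
  by congr (_ *: _); field; rewrite gt_eqF.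
apply/rowP => q; rewrite !mxE summxE eqxx /=.
have [qi|iq|qi] := ltngtP q i.
- rewrite (bigD1 q) //= big1 => [|j /andP[_ jq]].
    by rewrite !mxE !eqxx mulr1 addr0 subrr -val_eqE /= ltn_eqF // mulr0.
  by rewrite !mxE eq_sym (negPf jq) andbF mulr0.
- rewrite big1 => [|j ji].
    by rewrite subr0 -val_eqE /= gtn_eqF // mulr0.
  by rewrite !mxE eqxx -val_eqE /= gtn_eqF ?mulr0 // (ltn_trans ji).
- rewrite big1 => [|j ji].
    by rewrite -val_eqE /= qi eqxx mulr1 subr0 B_diag.
  by rewrite !mxE eqxx -val_eqE /= qi gtn_eqF ?mulr0.
Qed.

Lemma enorm_gs_tri_row (i : 'I_d) :
  enorm (gs (fun i : 'I_d => tri_row i) i) = F i.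
Proof.
rewrite gs_tri_row /enorm /dot (bigD1 i) //= big1 ?addr0 => [|q qi].
  by rewrite !mxE !eqxx mulr1 -expr2 sqrtr_sqr ger0_norm // ltW.
by rewrite !mxE (negPf qi) andbF !mulr0.
Qed.

End TriangularBasis.

(** * From projected lengths to HKZ and BKZ reduction *)

Section TriangularHKZ.
Variables (R : realType) (d k : nat) (B : nat -> nat -> R) (F : nat -> R).
Hypothesis F_gt0 : forall l, 0 < F l.
Hypothesis B_diag : forall l, (l < d)%N -> B l l = F l.
Hypothesis B_short : forall i j (z : nat -> int),
  (i <= j < d)%N -> (j < i + k)%N -> z j != 0 ->
  F i ^+ 2 <= proj_sqnorm R B i j.+1 (fun l => (z l)%:~R).

(** Let [j] be the last index with a nonzero coefficient in a competitor [w]. By [B_short] the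
    coordinates of [w] from [p] to [j] already have squared length at least [F p ^ 2], the squared
    norm of the first vector. *)
Lemma tri_row_shortest (p m : nat) : (p + m.+1 <= d)%N -> (m < k)%N ->
  is_shortest (fun l : 'I_m.+1 => trunc_row R d p (tri_row R d B (p + l)))
    (trunc_row R d p (tri_row R d B p)).
Proof.
move=> pmd mk; have pd : (p < d)%N by apply: leq_trans pmd; rewrite addnS ltnS leq_addr.
have row_p q : trunc_row R d p (tri_row R d B p) 0 q = F p * (q == Ordinal pd)%:R.
  rewrite !mxE -val_eqE /=; case: ltngtP => [||<-]; rewrite ?mulr0 //.
  by rewrite B_diag // mulr1.
split.
- exists (fun l => (l == ord0)%:Z); rewrite (bigD1 ord0) //= big1 => [|l l0].
    by rewrite addn0 scale1r addr0.
  by rewrite (negPf l0) scale0r.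
- apply/eqP => /(congr1 (fun v : 'rV_d => v 0 (Ordinal pd))).
  by rewrite row_p eqxx mulr1 mxE => /eqP; rewrite gt_eqF.
move=> w [z ->{w}] w0; set w := \sum_l _ in w0 *.
apply: ler_wsqrtr; rewrite [leLHS]/dot (bigD1 (Ordinal pd)) //= big1 => [|q qp]; last first.
  by rewrite row_p (negPf qp) !mulr0.
rewrite addr0 row_p eqxx mulr1.
pose Z l := oapp z 0 (insub (l - p)%N : option 'I_m.+1).
have wE (q : 'I_d) : (p <= q)%N -> w 0 q =
    \sum_(p <= l < p + m.+1) (Z l)%:~R * (if (q <= l)%N then B l q else 0).
  move=> pq; rewrite summxE -[X in index_iota X _]add0n big_addn addKn big_mkord.
  apply: eq_bigr => l _; rewrite !mxE pq /Z addnK addnC.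
  by rewrite (insubT (fun l => l < m.+1)%N (ltn_ord l)) /=;
    congr ((z _)%:~R * _); exact: val_inj.
(* The condition [p <= l] matters: truncated subtraction makes [Z l] equal to [z ord0] for
   [l < p]. *)
pose supp l := (p <= l < p + m.+1)%N && (Z l != 0).
have ex_supp : exists l, supp l.
  apply/not_existsP => nosupp; move: w0; rewrite (_ : w = 0) ?eqxx //.
  apply/rowP => q; rewrite [RHS]mxE; have [pq|qp] := leqP p q.
    rewrite wE // big_nat big1 // => l pl; rewrite (_ : Z l = 0) ?mul0r //.
    by apply/eqP/negbNE/negP => Zl; apply: (nosupp l); rewrite /supp pl.
  by rewrite summxE big1 // => l _; rewrite !mxE leqNgt qp mulr0.
have supp_le l : supp l -> (l <= p + m)%N by case/andP=> /andP[_]; rewrite addnS.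
case: (ex_maxnP ex_supp supp_le) => j /andP[/andP[pj jpm] Zj] jmax.
have jd : (j < d)%N := leq_trans jpm pmd.
rewrite -expr2; apply: (@le_trans _ _ (proj_sqnorm R B p j.+1 (fun l => (Z l)%:~R))).
  by apply: B_short; rewrite ?pj //; apply: leq_trans jpm _; rewrite leq_add2l.
have wq (q : 'I_d) : (p <= q < j.+1)%N -> w 0 q = \sum_(q <= l < j.+1) (Z l)%:~R * B l q.
  move=> /andP[pq qj]; rewrite wE //.
  have qpm : (q <= p + m.+1)%N := ltnW (leq_trans qj jpm).
  rewrite (big_cat_nat pq qpm) /=.
  rewrite big_nat big1 ?add0r => [|l /andP[_ lq]]; last by rewrite leqNgt lq mulr0.
  rewrite (big_cat_nat (ltnW qj) jpm) /= [X in _ + X]big_nat [X in _ + X]big1 ?addr0 => [|l].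
    by apply: eq_big_nat => l /andP[ql _]; rewrite ql.
  move=> /andP[jl lpm]; rewrite (_ : Z l = 0) ?mul0r //.
  apply/eqP/negbNE/negP => Zl; have := jl; rewrite ltnNge jmax //.
  by rewrite /supp Zl lpm (leq_trans pq (leq_trans (ltnW qj) jl)).
rewrite /dot /proj_sqnorm.
pose g q := if insub q is Some q' then w 0 (q' : 'I_d) * w 0 q' else 0.
have -> : \sum_(q < d) w 0 q * w 0 q = \sum_(0 <= q < d) g q.
  by rewrite big_mkord; apply: eq_bigr => q _; rewrite /g valK.
have g0 q : 0 <= g q by rewrite /g; case: insubP => // q' _ _; rewrite -expr2 sqr_ge0.
(* Coordinates outside the range from [p] to [j] contribute nonnegative squares and are dropped. *)
rewrite (big_cat_nat (leq0n p) (ltnW pd)) /= (big_cat_nat (leqW pj) jd) /=.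
rewrite (_ : \sum_(p <= q < j.+1) g q = proj_sqnorm R B p j.+1 (fun l => (Z l)%:~R)).
  by rewrite addrCA lerDl addr_ge0 // sumr_ge0.
apply: eq_big_nat => q /andP[pq qj].
have qd : (q < d)%N := leq_trans qj jd.
by rewrite /g insubT /= expr2 wq ?pq.
Qed.

(** Projecting orthogonally to its first vector turns the block at [p] into the shorter block at
    [p.+1], hence the induction over all lengths up to [k]. *)
Lemma tri_row_HKZ (p m : nat) : (p + m <= d)%N -> (m <= k)%N ->
  HKZ_reduced (fun l : 'I_m => trunc_row R d p (tri_row R d B (p + l))).
Proof.
elim: m p => [//|m IHm] p pmd mk; split.
  by have := tri_row_shortest p m pmd mk; rewrite [X in is_shortest _ X](_ : _ =
    trunc_row R d p (tri_row R d B (p + @ord0 m))) //= addn0.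
rewrite (_ : (fun i : 'I_m => _) =
    fun l : 'I_m => trunc_row R d p.+1 (tri_row R d B (p.+1 + l))).
  by apply: IHm; [rewrite addSnnS|exact: ltnW].
have pd : (p < d)%N by apply: leq_trans pmd; rewrite addnS ltnS leq_addr.
apply/funext => l; rewrite addn0 (proj_orth_trunc_row _ _ _ _ F_gt0 B_diag) //.
by rewrite lift0 addnS addSn.
Qed.

Lemma tri_row_BKZ : (k <= d)%N -> BKZ_reduced k (fun i : 'I_d => tri_row R d B i).
Proof.
move=> kd i ikd; rewrite (_ : (fun l : 'I_k => _) =
    fun l : 'I_k => trunc_row R d i (tri_row R d B (i + l))).
  exact: tri_row_HKZ.
by apply/funext => l; rewrite /block_proj (proj_orth_tri_rows R d B F F_gt0 B_diag).
Qed.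

End TriangularHKZ.

Theorem theorem6 (R : realType) (d k : nat) (f : 'I_d -> R)
    (k_lt_d : (k < d)%N)
    (f_gt0 : forall i : 'I_d, 0 < f i)
    (f_cond : forall j : 'I_d,
      \sum_(i < d | (i < j)%N && (j < i + k)%N)
        ((2 * pi * expR 1 / (j - i)%:R) `^ ((j - i)%:R / 2)
         * Num.max (1 - (f j / f i) ^+ 2) 0 `^ ((j - i)%:R / 2)
         * \prod_(l < d | (i <= l <= j)%N) (f i / f l)) < 1) :
  exists b : 'I_d -> 'rV[R]_d,
    [/\ lin_indep b, BKZ_reduced k b & forall i : 'I_d, enorm (gs b i) = f i].
Proof.
(* The default 1 keeps [F] positive at every natural index. *)
pose F l := oapp f 1 (insub l).
have FE (i : 'I_d) : F i = f i by rewrite /F valK.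
have F0 l : 0 < F l by rewrite /F; case: insubP => [u _ _|_] /=.
have [j jd|B [B_diag B_short]] := exists_triangular R F d k F0.
  have := f_cond (Ordinal jd); congr (_ < _).
  rewrite (big_ord_widen_cond d (fun i => (j < i + k)%N) (row_weight R F ^~ j) (ltnW jd)).
  apply: eq_big => [i|i /andP[ij _]]; first by rewrite andbC.
  rewrite /row_weight (FE (Ordinal jd) : F j = _) FE; congr (_ * _).
  rewrite big_geq_mkord (big_ord_widen_cond d (fun l => i <= l)%N
    (fun l => f i / F l)) //.
  by apply: eq_big => [l|l _]; rewrite ?FE // ltnS andbC.
exists (fun i : 'I_d => tri_row R d B i); split.
- exact: (tri_row_indep R d B F F0 B_diag).
- exact: (tri_row_BKZ R d k B F F0 B_diag B_short (ltnW k_lt_d)).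
- by move=> i; rewrite (enorm_gs_tri_row R d B F F0 B_diag).
Qed.
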